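(* Let $d\ge 3$. For every $P\in \mathcal{B}_d^\star$ and every $g\in GL_2(\mathbb{C})$ one has $$ID_d(g\cdot P)=g\cdot ID_d(P)\quad\text{in } Proj(\mathcal{B}_{2d-4}).$$ In other words, the natural actions of the Möbius group $\mathcal{M}\simeq PGL_2(\mathbb{C})$ on $Proj(\mathcal{B}_d^\star)$ and on $Proj(\mathcal{B}_{2d-4})$ commute with the bivariate isodynamic map $ID_d: Proj(\mathcal{B}_d^\star)\to Proj(\mathcal{B}_{2d-4})$.
   Context: $\mathcal{B}_n$ denotes the space of complex binary forms of degree $n$ (homogeneous polynomials of degree $n$ in two variables). $\mathcal{B}_d^\star\subset\mathcal{B}_d$ is the set of nonzero forms all of whose roots in $\mathbb{C}P^1$ have multiplicity at most $2$. $Proj$ denotes the set of nonzero elements considered up to a nonzero constant factor. Action: $g\in GL_2(\mathbb{C})$ acts on binary forms by $(g\cdot P)(\mathbf{x})=P(g^{-1}\mathbf{x})$, where $\mathbf{x}=(x,y)^T$, so that the zero locus of $g\cdot P$ in $\mathbb{C}P^1$ is the image under the Möbius transformation $g$ of the zero locus of $P$. After projectivization, this is an action of $\mathcal{M}\simeq PGL_2(\mathbb{C})$. Bivariate isodynamic map: to $P(x,y)\in\mathcal{B}_d^\star$ one associates the rational function $R_P=-\frac{P'_y(x,y)}{P'_x(x,y)}$ on $\mathbb{C}P^1$, where $P'_x,P'_y$ are the partial derivatives. $ID_d(P)$ is the binary form of degree $2d-4$ (up to a nonzero constant factor) whose projectivized zero divisor is the divisor of critical values of $R_P$. Precisely,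 including the case when $P$ has double roots (so that $P'_x$ and $P'_y$ have common factors), $$ID_d(P)(u,v)=\mathrm{Discr}_{(x,y)}\bigl(u\,P'_x(x,y)+v\,P'_y(x,y)\bigr),$$ the discriminant of the binary form of degree $d-1$ in $(x,y)$; it is a binary form of degree $2d-4$ in $(u,v)$. Here the discriminant of a binary form $F(x,y)=\prod_{i=1}^n(a_ix-b_iy)$ of degree $n$ is $\prod_{i<j}(a_ib_j-a_jb_i)^2$, extended as a polynomial in the coefficients of $F$. On the affine chart $y=v=1$, writing $p(z)=P(z,1)$, this is the discriminant with respect to $z$ of the polar derivative $d\,p(z)+(u-z)p'(z)$. *)

(* Defs.v *)
From HB Require Import structures.
From mathcomp Require Import all_boot all_order all_algebra.
From mathcomp Require Import classical_sets reals complex mpoly.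

Set Implicit Arguments.
Unset Strict Implicit.
Unset Printing Implicit Defensive.

Import GRing.Theory.
Local Open Scope ring_scope.

Section BinaryForms.
Context {C : numClosedFieldType}.
Implicit Types (P Q : {mpoly C[2]}) (g : 'M[C]_2) (n d : nat).

(* P and Q are forms of degree n representing the same point of Proj(B_n). *)
Definition proj_eq n P Q : Prop :=
  [/\ P \is n.-homog, P != 0, Q \is n.-homog, Q != 0 &
      exists2 c : C, c != 0 & P = c *: Q].

(* The linear form vanishing exactly at the point [p_0 : p_1] of CP^1. *)
Definition linear_form (p : 'cV[C]_2) : {mpoly C[2]} :=
  p 1 0 *: 'X_0 - p 0 0 *: 'X_1.

(* B_d^*.  The multiplicity of p as a root of P is the largest m such that
   linear_form p ^+ m divides P. *)
Definition Bstar d P : Prop :=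
  [/\ P \is d.-homog, P != 0 &
      forall (p : 'cV[C]_2) (m : nat) Q,
        p != 0 -> P = linear_form p ^+ m * Q -> (m <= 2)%N].

(* (g . P)(x) = P(g^-1 x), with x the column vector of the two variables. *)
Definition act g P : {mpoly C[2]} :=
  P \mPo [tuple \sum_(j < 2) invmx g i j *: 'X_j | i < 2].

(* The coefficient of x^(n-k) y^k. *)
Definition bcoef (A : nzRingType) n (F : {mpoly A[2]}) (k : nat) : A :=
  F@_(U_(0%R : 'I_2) *+ (n - k) + U_(1%R : 'I_2) *+ k)%MM.

(* D is the discriminant of binary forms of degree n, as a polynomial in their
   n + 1 coefficients: it takes the value \prod_(i < j) (a_i b_j - a_j b_i)^2
   at the form \prod_i (a_i x - b_i y). *)
Definition is_discr n (D : {mpoly C[n.+1]}) : Prop :=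
  forall a b : 'I_n -> C,
    D.@[fun k => bcoef n (\prod_(i < n) (a i *: 'X_0 - b i *: 'X_1)) k] =
    \prod_(i < n) \prod_(j < n | (i < j)%N) (a i * b j - a j * b i) ^+ 2.

(* For n > 0 exactly one polynomial satisfies is_discr n, so the default value
   0 of xget plays no role; 0 itself does not satisfy is_discr n. *)
Definition discr_poly n : {mpoly C[n.+1]} := xget 0 (@is_discr n).

(* The discriminant in (x, y) of a form of degree n in (x, y) whose
   coefficients are polynomials in (u, v). *)
Definition discr n (F : {mpoly {mpoly C[2]}[2]}) : {mpoly C[2]} :=
  discr_poly n \mPo [tuple bcoef n F k | k < n.+1].

(* The outer variables are (x, y), the inner ones (u, v): lift_xy embeds
   C[x, y] into C[u, v][x, y], and ('X_0)%:MP, ('X_1)%:MP are u, v. *)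
Definition lift_xy P : {mpoly {mpoly C[2]}[2]} := map_mpoly (@mpolyC 2 C) P.

Definition ID d P : {mpoly C[2]} :=
  discr d.-1 (('X_0)%:MP * lift_xy P^`M(0) + ('X_1)%:MP * lift_xy P^`M(1)).

End BinaryForms.

(* Main.v *)
Require Import Defs.
From HB Require Import structures.
From mathcomp Require Import all_boot all_order all_algebra.
From mathcomp Require Import classical_sets reals complex mpoly.
From mathcomp Require Import perm ring zify.

Set Implicit Arguments.
Unset Strict Implicit.
Unset Printing Implicit Defensive.

Import GRing.Theory.
Local Open Scope ring_scope.

(** The discriminant of a form is determined by its linear factors, so every
    identity about ID is checked pointwise.  At w = (u, v) the polynomial
    ID(P) takes the value Disc(D_w P), where D_w = u d/dx + v d/dy (lemma
    [meval_ID]).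

    Covariance.  For h = g^-1 the chain rule gives
    D_w (P o h) = (D_{hw} P) o h, and substituting h into a product of n linear
    forms multiplies each determinant a_i b_j - a_j b_i by det h.  Hence
    ID(P o h) = (det h)^(n(n-1)) ID(P) o h with n = d - 1 ([ID_subst]).
    In the same way Disc(c F) = c^(2n-2) Disc(F), which yields both the degree
    2d - 4 of ID(P) and its behaviour when P is rescaled.

    Existence of the discriminant.  [discr_poly] is defined by choice, so a
    polynomial in the coefficients with the prescribed values has to be
    exhibited.  The squared Vandermonde determinant is symmetric, hence a
    polynomial in the elementary symmetric functions; clearing the powers of
    the leading coefficient c_0 gives a polynomial equal to c_0^M Disc on the
    forms with c_0 <> 0, hence on all forms by density.  When M > 0 it vanishes
    on the hyperplane c_0 = 0, because every form splits, so that c_0 can be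
    divided out until M = 0 ([discr_exists]).

    Nonvanishing of ID(P) for P in B_d^*.  If D_w P has a multiple root at p,
    both its partial derivatives vanish there, i.e. w is in the kernel of the
    Hessian matrix of P at p; in particular p is a root of the Hessian
    determinant H.  When H is not the zero form it has finitely many roots, and
    at each of them the Hessian matrix is nonzero (otherwise P would have a
    triple root), so it kills at most one direction w.  Any other w has
    Disc(D_w P) <> 0 ([ID_neq0]).  That H is nonzero is seen at a root p of P:
    if the root is simple, H(p) <> 0; if it is double and L is the linear form
    vanishing at p, then H = L^2 K with K(p) <> 0 ([hessian_neq0]). *)

(** * Polynomials and their values *)

(** Maps compatible with sums and products are compared on constants and
    variables only; this serves for ring morphisms as well as derivations. *)
Lemma mpoly_ind_ring (C : comNzRingType) n (K : {mpoly C[n]} -> Prop) :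
  (forall c, K c%:MP) -> (forall i, K 'X_i) ->
  (forall p q, K p -> K q -> K (p + q)) ->
  (forall p q, K p -> K q -> K (p * q)) -> forall p, K p.
Proof.
move=> KC KX KD KM p; rewrite [p]mpolyE.
have K0 : K 0 by rewrite -[0]mpolyC0; apply: KC.
have K1 : K 1 by apply: (KC 1).
elim/big_ind: _ => // m _; rewrite -mul_mpolyC; apply: (KM) => //.
rewrite mpolyXE_id; elim/big_ind: _ => // i _.
by elim: (m i) => [|k IHk]; rewrite ?expr0 // exprS; apply: KM.
Qed.

Lemma muniXU (C : comNzRingType) n (i : 'I_n.+1) :
  muni ('X_i : {mpoly C[n.+1]}) =
    oapp (fun j : 'I_n => ('X_j)%:P) 'X (insub (val i)).
Proof.
rewrite /muni mmapX mmap1U; case: splitP => /= j ij; last first.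
  by rewrite insubF // ij ord1 /= addn0 ltnn.
case: insubP => [u _ uj|] /=; last by rewrite ij ltn_ord.
by congr ('X__)%:P; apply/val_inj; rewrite uj /= ij.
Qed.

(** Makes [muni] injective, so that a nonzero polynomial has a leading
    coefficient in its last variable. *)
Lemma muniK (C : comNzRingType) n :
  cancel (@muni n C) (fun q => (mpwiden q).['X_ord_max]).
Proof.
move=> p; elim/mpoly_ind_ring: p => [c|i|p q Ep Eq|p q Ep Eq].
- by rewrite muniC mpwidenC hornerC mwidenC.
- rewrite muniXU; case: insubP => [j _ ij|] /=.
    rewrite mpwidenC hornerC mwidenX mnmwiden1; congr 'X_ _.
    exact: val_inj.
  rewrite -leqNgt => le_ni; rewrite mpwidenX hornerX; congr 'X_ _.
  by apply/val_inj/eqP; rewrite /= eqn_leq le_ni -ltnS ltn_ord.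
- by rewrite -[RHS](congr2 +%R Ep Eq) muniD /mpwiden rmorphD hornerD.
- by rewrite -[RHS](congr2 *%R Ep Eq) muniM /mpwiden rmorphM hornerM.
Qed.

(** Induction on the number of variables: over an infinite field the leading
    coefficient in the last variable is nonzero somewhere, and at such a point a
    nonzero univariate polynomial remains. *)
Lemma meval_neq0_ex (C : closedFieldType) n (p : {mpoly C[n]}) :
  p != 0 -> exists v, p.@[v] != 0.
Proof.
elim: n p => [p|n IHn p nz_p].
  rewrite [p]nvar0_mpolyC mpolyC_eq0 => nz_p; exists (fun _ => 0).
  by rewrite mevalC.
(* u extends v by the value x of the last variable. *)
have evE (v : 'I_n -> C) (x : C) : exists u : 'I_n.+1 -> C, forall q,
    q.@[u] = (map_poly (meval v) (muni q)).[x].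
  exists (fun i => oapp v x (insub (val i))) => q.
  elim/mpoly_ind_ring: q => [c|i|q1 q2 E1 E2|q1 q2 E1 E2].
  - by rewrite mevalC muniC map_polyC /= mevalC hornerC.
  - rewrite mevalXU muniXU; case: insubP => [j _ _|_] /=.
      by rewrite map_polyC /= mevalXU hornerC.
    by rewrite map_polyX hornerX.
  - by rewrite mevalD muniD rmorphD hornerD E1 E2.
  - by rewrite mevalM muniM rmorphM hornerM E1 E2.
have nz_q : muni p != 0.
  apply: contraNneq nz_p => q0.
  by rewrite -[p]muniK q0 raddf0 horner0.
have [|v nz_v] := IHn (lead_coef (muni p)); first by rewrite lead_coef_eq0.
have /closed_nonrootP[x nz_x] : map_poly (meval v) (muni p) != 0.
  apply: contraNneq nz_v => /(congr1 (fun q : {poly C} => q`_(size (muni p)).-1)).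
  by rewrite coef_map coef0 lead_coefE => ->.
by have [u Eu] := evE v x; exists u; rewrite Eu.
Qed.

Lemma mpoly_ext (C : closedFieldType) n (p q : {mpoly C[n]}) :
  (forall v, p.@[v] = q.@[v]) -> p = q.
Proof.
move=> pq; apply/eqP; rewrite -subr_eq0; apply/negPn/negP.
by case/meval_neq0_ex=> v; rewrite mevalB pq subrr eqxx.
Qed.

Lemma homog_meval (C : comNzRingType) n d (p : {mpoly C[n]}) (l : C) v :
  p \is d.-homog -> p.@[fun i => l * v i] = l ^+ d * p.@[v].
Proof.
move=> /dhomogP hp; rewrite !mevalE mulr_sumr !big_seq.
apply: eq_bigr => m /hp <-; rewrite mulrCA; congr (_ * _).
under eq_bigr do rewrite exprMn.
by rewrite big_split /= prodrXr -mdegE.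
Qed.

(** Homogeneity can be tested on the single dilation by 2, because the powers
    of 2 are pairwise distinct in characteristic 0. *)
Lemma meval_homog (C : numClosedFieldType) n d (p : {mpoly C[n]}) :
  (forall v, p.@[fun i => 2 * v i] = 2 ^+ d * p.@[v]) -> p \is d.-homog.
Proof.
move=> hp; pose q := \sum_(m <- msupp p) (2 ^+ mdeg m * p@_m) *: 'X_[m].
have Eq : q = 2 ^+ d *: p.
  apply: mpoly_ext => v; rewrite mevalZ -hp [RHS]mevalE /q raddf_sum /=.
  apply: eq_bigr => m _; rewrite mevalZ mevalX.
  under [in RHS]eq_bigr do rewrite exprMn.
  by rewrite big_split /= prodrXr -mdegE [RHS]mulrCA mulrA.
have qE m : q@_m = 2 ^+ mdeg m * p@_m.
  rewrite raddf_sum /=; have [mp|mp] := boolP (m \in msupp p).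
    rewrite (bigD1_seq m) ?msupp_uniq //= big1 ?addr0 => [|k /negPf km].
      by rewrite mcoeffZ mcoeffX eqxx mulr1.
    by rewrite mcoeffZ mcoeffX km mulr0.
  rewrite (memN_msupp_eq0 mp) mulr0 big_seq big1 // => k kp.
  rewrite mcoeffZ mcoeffX; case: eqP kp mp => [->|_ _ _]; last by rewrite mulr0.
  by move=> ->.
apply/dhomogP => m; rewrite mcoeff_msupp => nz_m.
have := qE m; rewrite Eq mcoeffZ => /(mulIf nz_m) /esym E2.
apply/eqP; have /eqP := E2; rewrite -!natrX Num.Theory.eqr_nat.
by rewrite eqn_exp2l.
Qed.

(** * Products of linear forms and coefficients of binary forms *)

Lemma mmap_polyC_horner (C : comNzRingType) n (E : {mpoly C[n]})
    (c : 'I_n -> {poly C}) t :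
  (mmap polyC c E).[t] = E.@[fun i => (c i).[t]].
Proof.
elim/mpoly_ind_ring: E => [x|i|p q Ep Eq|p q Ep Eq].
- by rewrite mmapC mevalC hornerC.
- by rewrite mmapX mmap1U mevalXU.
- by rewrite mmapD mevalD hornerD Ep Eq.
- by rewrite rmorphM mevalM hornerM Ep Eq.
Qed.

Definition split_form (A : nzRingType) n (a b : 'I_n -> A) : {mpoly A[2]} :=
  \prod_(i < n) (a i *: 'X_0 - b i *: 'X_1).

(** The value prescribed by [is_discr] at a product of linear forms. *)
Definition root_discr (A : nzRingType) n (a b : 'I_n -> A) : A :=
  \prod_(i < n) \prod_(j < n | (i < j)%N) (a i * b j - a j * b i) ^+ 2.

(** Restriction to the affine chart y = 1. *)
Definition dehom (A : comNzRingType) (F : {mpoly A[2]}) : {poly A} :=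
  mmap polyC (fun i => if i == 0 then 'X else 1) F.

Lemma mnm2P (m1 m2 : 'X_{1..2}) :
  m1 0%R = m2 0%R -> m1 1%R = m2 1%R -> m1 = m2.
Proof.
move=> e0 e1; apply/mnmP => i.
have [->|->] // : i = 0 \/ i = 1.
by case: i => -[|[|//]] h; [left|right]; apply/val_inj.
Qed.

Lemma coef_dehom (A : comNzRingType) n (F : {mpoly A[2]}) k :
  F \is n.-homog -> (k <= n)%N -> (dehom F)`_(n - k) = bcoef n F k.
Proof.
move=> /dhomogP hF le_kn; rewrite /bcoef; set M := (_ + _)%MM.
have M0 : M 0%R = (n - k)%N by rewrite mnmDE !mulmnE !mnm1E /= mul1n addn0.
have M1 : M 1%R = k by rewrite mnmDE !mulmnE !mnm1E /= mul1n.
rewrite /dehom /mmap coef_sum /=.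
have termE m : ((F@_m)%:P * mmap1 (fun i => if i == 0 then 'X else 1) m)`_(n - k)
    = F@_m * ((n - k)%N == m 0%R)%:R.
  rewrite /mmap1 !big_ord_recl big_ord0 /= expr1n !mulr1.
  by rewrite coefCM coefXn.
rewrite (eq_bigr _ (fun m _ => termE m)).
have inM m : m \in msupp F -> (n - k)%N = m 0%R -> m = M.
  move=> /hF degm e; have {}degm : mdeg m = n := degm.
  apply: mnm2P; rewrite ?M0 // M1; apply/eqP.
  rewrite -(eqn_add2l (m 0%R)) -{2}e subnK // -degm mdegE !big_ord_recl big_ord0.
  by rewrite addn0; apply/eqP; congr (_ + m _)%N; apply/val_inj.
have [MF|MF] := boolP (M \in msupp F); last first.
  rewrite (memN_msupp_eq0 MF) big_seq big1 // => m mF.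
  case: eqP => [/(inM _ mF) mM|]; last by rewrite mulr0.
  by rewrite -mM mF in MF.
rewrite (bigD1_seq M) ?msupp_uniq //= M0 eqxx mulr1 big_seq_cond big1 ?addr0 //.
move=> m /andP[mF /negP nmM]; case: eqP => [/(inM _ mF) mM|]; last by rewrite mulr0.
by case: nmM; apply/eqP.
Qed.

Lemma linear_homog (A : comNzRingType) (a b : A) :
  (a *: 'X_0 - b *: 'X_1 : {mpoly A[2]}) \is 1.-homog.
Proof. have XU i : ('X_i : {mpoly A[2]}) \is 1.-homog.
  by rewrite dhomogX; apply/eqP/mdeg1.
by rewrite rpredB // rpredZ. Qed.

Lemma split_form_homog (A : comNzRingType) n (a b : 'I_n -> A) :
  split_form a b \is n.-homog.
Proof.
elim: n a b => [|n IHn] a b; first by rewrite /split_form big_ord0 dhomog1.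
rewrite /split_form big_ord_recl.
exact: dhomogM (linear_homog _ _) (IHn _ _).
Qed.

(** Coefficients of products are computed in the chart y = 1, where they
    become coefficients of univariate polynomials. *)
Lemma bcoef_split_form (A : comNzRingType) n (a b : 'I_n -> A) (k : 'I_n.+1) :
  bcoef n (split_form a b) k =
    (\prod_(i < n) (a i *: 'X - (b i)%:P))`_(n - k).
Proof.
rewrite -coef_dehom ?split_form_homog -1?ltnS //; congr (_`__).
rewrite /dehom /split_form rmorph_prod.
rewrite (eq_bigr (fun i => a i *: 'X - (b i)%:P)) // => i _ /=.
by rewrite mmapB !mmapZ !mmapX !mmap1U /= mulr1 mul_polyC.
Qed.

Lemma bcoef0_split_form (A : comNzRingType) n (a b : 'I_n -> A) :
  bcoef n (split_form a b) 0 = \prod_(i < n) a i.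
Proof.
rewrite (bcoef_split_form a b ord0) subn0.
suff [] : (size (\prod_(i < n) (a i *: 'X - (b i)%:P) : {poly A})%R <= n.+1)%N /\
  (\prod_(i < n) (a i *: 'X - (b i)%:P))`_n = \prod_(i < n) a i by [].
elim: n a b => [|n IHn] a b; first by rewrite !big_ord0 coef1 size_poly1.
rewrite !big_ord_recr /=; set p := \prod_(i < n) _.
have [sp cp] := IHn (fun i => a (widen_ord (leqnSn n) i))
                    (fun i => b (widen_ord (leqnSn n) i)).
have coefE k : (p * (a ord_max *: 'X - (b ord_max)%:P))`_k.+1 =
    p`_k * a ord_max - p`_k.+1 * b ord_max.
  by rewrite mulrBr coefB -scalerAr coefZ coefMX coefMC /= mulrC.
split; last by rewrite coefE cp [p`_n.+1]nth_default ?mul0r ?subr0.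
apply/leq_sizeP => -[//|k] lt_nk; rewrite coefE !nth_default ?mul0r ?subr0 //.
  by rewrite (leq_trans sp) // ltnW.
exact: leq_trans sp _.
Qed.

(** * Existence of the discriminant *)

(** Euclidean division by the first variable; the remainder B does not
    depend on that variable. *)
Lemma mpoly_split_X0 (C : comNzRingType) n (E : {mpoly C[n.+1]}) :
  exists A B, E = 'X_0 * A + B /\
    forall v w, (forall i, i != 0 -> v i = w i) -> B.@[v] = B.@[w].
Proof.
elim/mpoly_ind_ring: E => [c|i|p q [A [B [-> hB]]] [A' [B' [-> hB']]]
                              |p q [A [B [-> hB]]] [A' [B' [-> hB']]]].
- by exists 0, c%:MP; rewrite mulr0 add0r; split=> // v w _; rewrite !mevalC.
- have [->|i0] := eqVneq i 0.
    by exists 1, 0; rewrite mulr1 addr0; split=> // v w _; rewrite !meval0.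
  by exists 0, 'X_i; rewrite mulr0 add0r; split=> // v w h; rewrite !mevalXU h.
- exists (A + A'), (B + B'); split; first by rewrite mulrDr addrACA.
  by move=> v w h; rewrite !mevalD (hB v w) // (hB' v w).
- exists (A * ('X_0 * A' + B') + B * A'), (B * B'); split; first by ring.
  by move=> v w h; rewrite !mevalM (hB v w) // (hB' v w).
Qed.

Lemma mpoly_divX0 (C : closedFieldType) n (E : {mpoly C[n.+1]}) :
  (forall v, v 0 = 0 -> E.@[v] = 0) -> exists A, E = 'X_0 * A.
Proof.
move=> hE; have [A [B [EAB hB]]] := mpoly_split_X0 E; exists A.
suff B0 : B = 0 by rewrite EAB B0 addr0.
apply: mpoly_ext => v; rewrite meval0.
pose w i := if i == 0 then 0 else v i.
have := hE w (erefl _); rewrite EAB mevalD mevalM mevalXU mul0r add0r => <-.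
by apply: hB => i /negPf i0; rewrite /w i0.
Qed.

(** Two polynomial expressions in (a, b) that agree when every a i is nonzero
    agree everywhere: along the line a + t they are polynomials in t that agree
    for all but finitely many t. *)
Lemma split_form_density (C : closedFieldType) n (E : {mpoly C[n.+1]}) k :
  (forall a b : 'I_n -> C, (forall i, a i != 0) ->
     E.@[fun j => bcoef n (split_form a b) j] =
     (\prod_(i < n) a i) ^+ k * root_discr a b) ->
  forall a b : 'I_n -> C, E.@[fun j => bcoef n (split_form a b) j] =
     (\prod_(i < n) a i) ^+ k * root_discr a b.
Proof.
move=> hE a b; pose al i := (a i)%:P + 'X; pose be i := (b i)%:P.
pose q := mmap polyC (fun j : 'I_n.+1 => bcoef n (split_form al be) j) E
  - (\prod_(i < n) al i) ^+ k * root_discr al be.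
have alE i t : (al i).[t] = a i + t by rewrite !hornerE.
have qE t : q.[t] =
    E.@[fun j => bcoef n (split_form (fun i => a i + t) b) j] -
    (\prod_(i < n) (a i + t)) ^+ k * root_discr (fun i => a i + t) b.
  rewrite hornerD hornerN mmap_polyC_horner hornerM horner_exp horner_prod.
  congr (_ - _ ^+ _ * _).
  - apply: meval_eq => j; rewrite !bcoef_split_form.
    rewrite -[LHS]/(horner_eval t _) -coef_map rmorph_prod /=; congr (_`__).
    rewrite (eq_bigr (fun i => (a i + t) *: 'X - (b i)%:P)) // => i _.
    by rewrite rmorphB /= map_polyZ /= map_polyX map_polyC /= /horner_eval alE hornerC.
  - by apply: eq_bigr => i _; rewrite alE.
  rewrite horner_prod; apply: eq_bigr => i _; rewrite horner_prod.
  by apply: eq_bigr => j _; rewrite !hornerE.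
have nz_al : \prod_(i < n) al i != 0.
  by apply/prodf_neq0 => i _; rewrite /al addrC -[a i]opprK polyCN polyXsubC_eq0.
have q0 : q = 0.
  apply/eqP/negPn/negP => nz_q.
  have /closed_nonrootP[t] : q * \prod_(i < n) al i != 0 by rewrite mulf_neq0.
  rewrite rootM negb_or => /andP[/negP nq /negP na]; apply: nq.
  rewrite /root qE hE ?subrr // => i; apply/negP => /eqP ati; apply: na.
  by rewrite /root horner_prod (bigD1 i) //= alE ati mul0r.
have := qE 0; rewrite q0 horner0 => /esym/subr0_eq.
have a0 : (fun i => a i + 0) =1 a by move=> i; rewrite addr0.
rewrite (meval_eq (v2 := fun j => bcoef n (split_form a b) j)) => [->|j].
  congr (_ ^+ _ * _); first by apply: eq_bigr.
  by apply: eq_bigr => i _; apply: eq_bigr => j _; rewrite !a0.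
rewrite !bcoef_split_form; congr (_`__).
by rewrite (eq_bigr (fun i => a i *: 'X - (b i)%:P)) // => i _; rewrite a0.
Qed.

(** S evaluated at the ratios of c to its coordinate c 0 becomes polynomial
    after multiplication by a power of c 0; s allows for signs. *)
Lemma mpoly_homogenize (C : fieldType) n (s : C ^ n) (S : {mpoly C[n]}) :
  exists M (E : {mpoly C[n.+1]}), forall c : 'I_n.+1 -> C, c 0 != 0 ->
    E.@[c] = c 0 ^+ M * S.@[fun i => s i * c (lift ord0 i) / c 0].
Proof.
elim/mpoly_ind_ring: S => [x|i|p q [M [E hE]] [M' [E' hE']]
                              |p q [M [E hE]] [M' [E' hE']]].
- by exists 0, x%:MP => c _; rewrite expr0 mul1r !mevalC.
- exists 1, (s i *: 'X_(lift ord0 i)) => c c0.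
  by rewrite mevalZ !mevalXU expr1 [RHS]mulrC divfK.
- exists (M + M')%N, ('X_0 ^+ M' * E + 'X_0 ^+ M * E') => c c0.
  by rewrite !mevalD !mevalM !rmorphXn /= !mevalXU hE // hE' // exprD; ring.
- exists (M + M')%N, (E * E') => c c0.
  by rewrite !mevalM hE // hE' // exprD; ring.
Qed.

(** A permutation of the variables permutes the columns of the Vandermonde
    matrix, and the sign that appears is squared. *)
Lemma vandermonde_sqr_sym (C : comNzRingType) n :
  (\det (Vandermonde n (\row_(j < n) ('X_j : {mpoly C[n]})))) ^+ 2 \is symmetric.
Proof.
apply/issymP => s; rewrite [in LHS]expr2 msymM -expr2.
have -> : msym s (\det (Vandermonde n (\row_(j < n) ('X_j : {mpoly C[n]})))) =
    \det (col_perm s (Vandermonde n (\row_(j < n) ('X_j : {mpoly C[n]})))).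
  rewrite -det_map_mx; congr (\det _); apply/matrixP => i j; rewrite !mxE.
  rewrite rmorphXn /=; congr (_ ^+ _); rewrite msymX; congr 'X_[_].
  by apply/mnmP => k; rewrite !mnmE (can2_eq (permK s) (permKV s)).
by rewrite col_permE det_mulmx det_perm exprMn sqrr_sign mulr1.
Qed.

Lemma root_discr_poly (C : closedFieldType) n : exists S : {mpoly C[n]},
  forall r : 'I_n -> C,
    S.@[fun i => (mesym n C i.+1).@[r]] =
    \prod_(i < n) \prod_(j < n | (i < j)%N) (r j - r i) ^+ 2.
Proof.
have [S [ES _]] := sym_fundamental (vandermonde_sqr_sym C n).
exists S => r.
transitivity ((\det (Vandermonde n (\row_(j < n) ('X_j : {mpoly C[n]})))) ^+ 2).@[r].
  by rewrite -ES comp_mpoly_meval; apply: meval_eq => i; rewrite tnth_mktuple.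
rewrite rmorphXn /= det_Vandermonde rmorph_prod -prodrXl.
apply: eq_bigr => i _; rewrite rmorph_prod -prodrXl; apply: eq_bigr => j _.
by rewrite !mxE rmorphB /= !mevalXU.
Qed.

(** Each index occurs in exactly n - 1 pairs. *)
Lemma prod_pairs (A : comNzRingType) n (f : 'I_n -> A) :
  \prod_(i < n) \prod_(j < n | (i < j)%N) (f i * f j) = (\prod_(i < n) f i) ^+ n.-1.
Proof.
under eq_bigr do rewrite big_split /=.
rewrite big_split /= [X in _ * X](exchange_big_dep xpredT) //= -big_split /=.
rewrite -prodrXl; apply: eq_bigr => i _.
rewrite -[n in n.-1]card_ord -(cardC1 i) -prodr_const.
rewrite [RHS](bigID (fun j : 'I_n => (i < j)%N)) /=.
congr (_ * _); apply: eq_bigl => j; rewrite !inE -val_eqE /=; lia.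
Qed.

Lemma root_discr_scale (A : comNzRingType) n (f a b : 'I_n -> A) :
  root_discr (fun i => f i * a i) (fun i => f i * b i) =
  (\prod_(i < n) f i) ^+ (n.-1 * 2) * root_discr a b.
Proof.
rewrite exprM -prod_pairs -prodrXl -big_split; apply: eq_bigr => i _ /=.
by rewrite -prodrXl -big_split; apply: eq_bigr => j _ /=; ring.
Qed.

(** A polynomial in the coefficients which is the discriminant up to a power
    of the leading coefficient: the roots are b i / a i, their elementary
    symmetric functions are ratios of coefficients, and the powers of c_0 come
    from [mpoly_homogenize]. *)
Lemma discr_pole (C : closedFieldType) n : exists M (E : {mpoly C[n.+1]}),
  forall a b : 'I_n -> C, (forall i, a i != 0) ->
     E.@[fun j => bcoef n (split_form a b) j] =
     (\prod_(i < n) a i) ^+ M * root_discr a b.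
Proof.
have [S hS] := root_discr_poly C n.
have [M [E hE]] := mpoly_homogenize [ffun i : 'I_n => (-1) ^+ i.+1] S.
exists M, ('X_0 ^+ (n.-1 * 2) * E) => a b a0.
pose r i := b i / a i; pose c := \prod_(i < n) a i.
have c0 : c != 0 by apply/prodf_neq0.
have bc0 : bcoef n (split_form a b) 0 = c by apply: bcoef0_split_form.
rewrite mevalM rmorphXn /= mevalXU hE bc0 // mulrCA; congr (_ * _).
have -> : root_discr a b = c ^+ (n.-1 * 2) *
    \prod_(i < n) \prod_(j < n | (i < j)%N) (r j - r i) ^+ 2.
  transitivity (c ^+ (n.-1 * 2) * root_discr (fun _ => 1) r); last first.
    by congr (_ * _); do 2!apply: eq_bigr => ? _; rewrite !mul1r.
  rewrite -root_discr_scale; do 2!apply: eq_bigr => ? _.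
  by rewrite !mulr1 /r ![a _ * (_ / _)]mulrC !divfK.
congr (_ * _); rewrite -hS; apply: meval_eq => i.
rewrite ffunE bcoef_split_form.
have -> : \prod_(j < n) (a j *: 'X - (b j)%:P) =
    c *: \prod_(x <- [tuple r j | j < n]) ('X - x%:P).
  rewrite big_tuple -scaler_prod; apply: eq_bigr => j _.
  rewrite tnth_mktuple scalerBr; congr (_ - _).
  by rewrite -mul_polyC -polyCM /r mulrC divfK.
have := mroots_coeff [tuple r j | j < n] (lift ord0 i).
rewrite coefZ => ->; rewrite mulrCA mulrC mulKf //.
rewrite lift0 mulrA -expr2 sqrr_sign mul1r; apply: meval_eq => j; exact: tnth_mktuple.
Qed.

(** Factors with a i = 0 stand for roots at infinity: they absorb the gap
    between the degree of p and the number of factors, and the constant. *)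
Lemma poly_split (C : closedFieldType) n (p : {poly C}) : (size p <= n.+2)%N ->
  exists a b : 'I_n.+1 -> C, \prod_(i < n.+1) (a i *: 'X - (b i)%:P) = p.
Proof.
elim: n p => [|n IHn] p sp.
  exists (fun _ => p`_1), (fun _ => - p`_0); rewrite big_ord1 polyCN opprK.
  apply/polyP => -[|[|k]]; rewrite coefD coefZ coefX coefC /=.
  - by rewrite mulr0 add0r.
  - by rewrite mulr1 addr0.
  - by rewrite mulr0 addr0 nth_default // (leq_trans sp).
have snoc a0 b0 (q : {poly C}) : (size q <= n.+2)%N -> p = q * (a0 *: 'X - b0%:P) ->
    exists a b : 'I_n.+2 -> C, \prod_(i < n.+2) (a i *: 'X - (b i)%:P) = p.
  move=> /IHn[a [b Eq]] ->; rewrite -Eq.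
  exists (fun i => oapp a a0 (unlift ord_max i)), (fun i => oapp b b0 (unlift ord_max i)).
  rewrite big_ord_recr /= unlift_none /=; congr (_ * _).
  apply: eq_bigr => i _.
  have -> : widen_ord (leqnSn n.+1) i = lift ord_max i.
    by apply/val_inj; rewrite /= /bump leqNgt ltn_ord.
  by rewrite liftK.
have [sp'|sp'] := leqP (size p) n.+2.
  by apply: (snoc 0 (-1) p) => //; rewrite scale0r sub0r polyCN opprK mulr1.
have /closed_rootP[r rp] : size p != 1%N by case: (size p) sp' => [|[]].
have [q Eq] := factor_theorem _ _ rp.
have nz_p : p != 0 by rewrite -size_poly_gt0 (leq_trans _ sp').
apply: (snoc 1 r q); last by rewrite scale1r.
have := sp; rewrite Eq size_Mmonic ?monicXsubC ?size_XsubC ?addn2 //.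
by apply: contraNneq nz_p => q0; rewrite Eq q0 mul0r.
Qed.

Lemma bcoef_ext (A : nzRingType) n (P Q : {mpoly A[2]}) :
  P \is n.-homog -> Q \is n.-homog ->
  (forall k, (k <= n)%N -> bcoef n P k = bcoef n Q k) -> P = Q.
Proof.
move=> hP hQ PQ; apply/mpolyP => m; have [degm|degm] := eqVneq (mdeg m) n; last first.
  by rewrite (dhomog_nemf_coeff hP) ?(dhomog_nemf_coeff hQ).
have degE : (m 0%R + m 1%R)%N = n.
  rewrite -degm mdegE !big_ord_recl big_ord0 addn0; congr (_ + m _)%N.
  exact: val_inj.
have := PQ (m 1%R); rewrite -{1}degE leq_addl => /(_ isT); rewrite /bcoef.
suff -> : (U_(0%R : 'I_2) *+ (n - m 1%R) + U_(1%R : 'I_2) *+ m 1%R)%MM = m by [].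
by apply: mnm2P; rewrite mnmDE !mulmnE !mnm1E /= !mul1n ?addn0 // -degE addnK.
Qed.

(** In the chart y = 1 this is the factorization of a univariate polynomial;
    the zero form is covered because there is at least one factor. *)
Lemma homog_split (C : closedFieldType) n (P : {mpoly C[2]}) :
  P \is n.+1.-homog -> exists a b : 'I_n.+1 -> C, P = split_form a b.
Proof.
move=> hP; pose p := \poly_(i < n.+2) bcoef n.+1 P (n.+1 - i).
have [a [b Eab]] := @poly_split C n p (size_poly _ _).
exists a, b; apply: bcoef_ext (hP) (split_form_homog _ _) _ => k.
rewrite -ltnS => lt_kn.
rewrite (bcoef_split_form a b (Ordinal lt_kn)) Eab coef_poly /= ltnS leq_subr.
by rewrite subKn.
Qed.

(** A positive power of the leading coefficient can always be cancelled: it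
    makes the polynomial vanish on the hyperplane c_0 = 0, all of whose points
    are coefficient vectors of products of linear forms. *)
Lemma discr_exists (C : numClosedFieldType) n :
  exists D : {mpoly C[n.+2]}, is_discr D.
Proof.
have [M [E0 /split_form_density hE0]] := discr_pole C n.+1.
elim: M E0 hE0 => [|M IHM] E hE.
  by exists E => a b; rewrite -/(split_form a b) hE expr0 mul1r.
have [v v0|A EA] := @mpoly_divX0 C n.+1 E.
  pose p := \poly_(i < n.+2) v (inord (n.+1 - i)).
  have [a [b Eab]] := @poly_split C n p (size_poly _ _).
  have cv (j : 'I_n.+2) : bcoef n.+1 (split_form a b) j = v j.
    rewrite bcoef_split_form Eab coef_poly ltnS leq_subr subKn ?inord_val //.
    by rewrite -ltnS.
  rewrite -(meval_eq (v1 := fun j => bcoef n.+1 (split_form a b) j)) //.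
  have c0 : \prod_(i < n.+1) a i = 0.
    by rewrite -(bcoef0_split_form a b) -v0; apply: (cv 0).
  by rewrite hE c0 exprS !mul0r.
apply: (IHM A); apply: split_form_density => a b a0.
have c0 : \prod_(i < n.+1) a i != 0 by apply/prodf_neq0.
apply: (mulfI c0); rewrite mulrA -exprS -hE EA mevalM mevalXU.
by rewrite bcoef0_split_form.
Qed.

(** * Linear substitutions and directional derivatives *)

Definition lin (C : nzRingType) (h : 'M[C]_2) (v : 'I_2 -> C) : 'I_2 -> C :=
  fun i => \sum_(j < 2) h i j * v j.

(** [act g] is, by definition, [subst (invmx g)]; the theory is simpler
    without the inverse. *)
Definition subst (C : nzRingType) (h : 'M[C]_2) (P : {mpoly C[2]}) : {mpoly C[2]} :=
  P \mPo [tuple \sum_(j < 2) h i j *: 'X_j | i < 2].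

Definition dir_deriv (C : nzRingType) (w : 'I_2 -> C) (P : {mpoly C[2]}) : {mpoly C[2]} :=
  w 0 *: P^`M(0) + w 1 *: P^`M(1).

Lemma sum2E (V : nmodType) (F : 'I_2 -> V) : \sum_(i < 2) F i = F 0 + F 1.
Proof.
by rewrite !big_ord_recl big_ord0 addr0; congr (_ + F _); apply/val_inj.
Qed.

Lemma forall2 (Q : 'I_2 -> Prop) : Q 0 -> Q 1 -> forall i, Q i.
Proof.
move=> Q0 Q1 i; have [->|->] // : i = 0 \/ i = 1.
by case: i => -[|[|//]] ?; [left|right]; apply/val_inj.
Qed.

Section Subst.
Variable C : comNzRingType.
Implicit Types (h : 'M[C]_2) (P Q : {mpoly C[2]}).

Lemma substM h P Q : subst h (P * Q) = subst h P * subst h Q.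
Proof. exact: rmorphM. Qed.
Lemma substD h P Q : subst h (P + Q) = subst h P + subst h Q.
Proof. exact: raddfD. Qed.
Lemma substC h c : subst h c%:MP = c%:MP.
Proof. exact: comp_mpolyC. Qed.
Lemma substX h P k : subst h (P ^+ k) = subst h P ^+ k.
Proof. exact: rmorphXn. Qed.
Lemma substZ h c P : subst h (c *: P) = c *: subst h P.
Proof. exact: comp_mpolyZ. Qed.
Lemma substXU h i : subst h 'X_i = h i 0 *: 'X_0 + h i 1 *: 'X_1.
Proof.
by rewrite /subst comp_mpolyXU -tnth_nth tnth_mktuple sum2E.
Qed.

Lemma meval_subst h P v : (subst h P).@[v] = P.@[lin h v].
Proof.
rewrite /subst comp_mpoly_meval; apply: meval_eq => i.
by rewrite tnth_mktuple raddf_sum; apply: eq_bigr => j _ /=; rewrite mevalZ mevalXU.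
Qed.

Lemma subst_subst g h P : subst g (subst h P) = subst (h *m g) P.
Proof.
elim/mpoly_ind_ring: P => [c|i|P Q EP EQ|P Q EP EQ].
- by rewrite !substC.
- rewrite !substXU substD !substZ !substXU !mxE !sum2E -!mul_mpolyC.
  by rewrite !mpolyCD !mpolyCM; ring.
- by rewrite !substD EP EQ.
- by rewrite !substM EP EQ.
Qed.

Lemma subst1 P : subst 1%:M P = P.
Proof.
elim/mpoly_ind_ring: P => [c|i|P Q EP EQ|P Q EP EQ].
- by rewrite substC.
- rewrite substXU; elim/forall2: i => //; rewrite !mxE /= scale1r scale0r.
    by rewrite addr0.
  by rewrite add0r.
- by rewrite substD EP EQ.
- by rewrite substM EP EQ.
Qed.

Lemma mderivXU (k i : 'I_2) : ('X_k : {mpoly C[2]})^`M(i) = (k == i)%:R%:MP.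
Proof.
rewrite mderivX mnm1E; case: eqP => [->|_]; last by rewrite scale0r mpolyC0.
rewrite scale1r -[RHS](@mpolyX0 2 C); congr 'X_[_].
by apply/mnmP => j; rewrite mnmBE mnm0E subnn.
Qed.

Lemma mderiv_subst h P i :
  (subst h P)^`M(i) = h 0 i *: subst h P^`M(0) + h 1 i *: subst h P^`M(1).
Proof.
elim/mpoly_ind_ring: P => [c|k|P Q EP EQ|P Q EP EQ].
- by rewrite substC !mderivC /subst !comp_mpoly0 !scaler0 addr0.
- rewrite substXU mderivD !mderivZ !mderivXU !substC -!mul_mpolyC -!mpolyCM -!mpolyCD.
  by congr (_%:MP); elim/forall2: i; elim/forall2: k; rewrite /= ?mulr0 ?mulr1 ?addr0 ?add0r.
- rewrite substD !mderivD !substD EP EQ !scalerDr addrACA; congr (_ + _).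
- rewrite substM !mderivM !substD !substM EP EQ -!mul_mpolyC; ring.
Qed.

End Subst.

(** * Transformation of discriminants and covariance of ID *)

Definition disc (C : numClosedFieldType) n (F : {mpoly C[2]}) : C :=
  (discr_poly n).@[fun k : 'I_n.+1 => bcoef n F k].

(** By [discr_exists], the choice made in [discr_poly] satisfies [is_discr]. *)
Lemma disc_split_form (C : numClosedFieldType) n (a b : 'I_n.+1 -> C) :
  disc n.+1 (split_form a b) = root_discr a b.
Proof. exact: (xgetPex _ (discr_exists C n)). Qed.

Lemma split_form_scale (C : comNzRingType) n (f a b : 'I_n -> C) :
  split_form (fun i => f i * a i) (fun i => f i * b i) =
  (\prod_(i < n) f i) *: split_form a b.
Proof.
rewrite -scaler_prod; apply: eq_bigr => i _.
by rewrite scalerBr !scalerA.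
Qed.

(** There are n (n - 1) / 2 pairs, each contributing c ^ 2. *)
Lemma root_discrE (C : comNzRingType) n (a b a' b' : 'I_n -> C) (c : C) :
  (forall i j, a' i * b' j - a' j * b' i = c * (a i * b j - a j * b i)) ->
  root_discr a' b' = c ^+ (n * n.-1) * root_discr a b.
Proof.
move=> E; have -> : c ^+ (n * n.-1) = \prod_(i < n) \prod_(j < n | (i < j)%N) (c * c).
  by rewrite prod_pairs prodr_const card_ord exprM.
rewrite -big_split; apply: eq_bigr => i _; rewrite -big_split; apply: eq_bigr => j _.
by rewrite /= E exprMn.
Qed.

Lemma det2E (C : comNzRingType) (h : 'M[C]_2) : \det h = h 0 0 * h 1 1 - h 0 1 * h 1 0.
Proof.
rewrite (expand_det_row _ 0) sum2E /cofactor !det_mx11 !mxE /= expr0 expr1 mul1r mulN1r mulrN.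
by congr (_ * h _ _ - _ * h _ _); apply/val_inj.
Qed.

Lemma subst_split_form (C : comNzRingType) (h : 'M[C]_2) n (a b : 'I_n -> C) :
  subst h (split_form a b) =
  split_form (fun i => a i * h 0 0 - b i * h 1 0) (fun i => b i * h 1 1 - a i * h 0 1).
Proof.
rewrite /split_form /subst rmorph_prod.
rewrite [RHS](eq_bigr (fun i => subst h (a i *: 'X_0 - b i *: 'X_1))) // => i _.
rewrite substD -[in RHS]scaleNr !substZ !substXU.
by rewrite -!mul_mpolyC mpolyCN !mpolyCB !mpolyCM; ring.
Qed.

Lemma disc_subst (C : numClosedFieldType) (h : 'M[C]_2) n F : F \is n.+1.-homog ->
  disc n.+1 (subst h F) = \det h ^+ (n.+1 * n) * disc n.+1 F.
Proof.
move=> /homog_split[a [b ->]]; rewrite subst_split_form !disc_split_form.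
by apply: root_discrE => i j; rewrite det2E; ring.
Qed.

(** The scalar is put into one linear factor only, which is involved in n of
    the pairs. *)
Lemma disc_scale (C : numClosedFieldType) (c : C) n F : F \is n.+1.-homog ->
  disc n.+1 (c *: F) = c ^+ (n * 2) * disc n.+1 F.
Proof.
move=> /homog_split[a [b ->]].
pose f (i : 'I_n.+1) := if i == 0 then c else 1.
have fE : \prod_(i < n.+1) f i = c.
  by rewrite (bigD1 0) //= big1 ?mulr1 // => i /negPf; rewrite /f => ->.
by rewrite -[in LHS]fE -split_form_scale !disc_split_form root_discr_scale fE.
Qed.

Lemma mderiv_homog (C : numDomainType) n i (P : {mpoly C[2]}) :
  P \is n.+1.-homog -> P^`M(i) \is n.-homog.
Proof.
move=> hP; apply/dhomogP => m; rewrite mcoeff_msupp mcoeff_deriv => nz.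
have : (m + U_(i))%MM \in msupp P.
  by rewrite mcoeff_msupp; apply: contraNneq nz => ->; rewrite mul0rn.
have /dhomogP dP := hP; move/dP => dm; have {dm} : mdeg (m + U_(i))%MM = n.+1 by [].
by rewrite mdegD mdeg1 addn1 => -[].
Qed.

Lemma dir_deriv_homog (C : numDomainType) n w (P : {mpoly C[2]}) :
  P \is n.+1.-homog -> dir_deriv w P \is n.-homog.
Proof. by move=> hP; rewrite rpredD // rpredZ // mderiv_homog. Qed.

Lemma mcoeff_lift_xy_comb (C : numClosedFieldType) (c0 c1 : {mpoly C[2]}) P Q m :
  (c0%:MP * lift_xy P + c1%:MP * lift_xy Q)@_m =
  c0 * (P@_m)%:MP + c1 * (Q@_m)%:MP.
Proof.
rewrite [LHS]mcoeffD; congr (_ + _).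
  by rewrite [LHS]mcoeffCM; congr (_ * _); apply: mcoeff_map_mpoly.
by rewrite [LHS]mcoeffCM; congr (_ * _); apply: mcoeff_map_mpoly.
Qed.

(** Evaluation at w commutes with taking the discriminant, so that ID(P)
    at w is the discriminant of the derivative of P in the direction w. *)
Lemma meval_ID (C : numClosedFieldType) d (P : {mpoly C[2]}) w :
  (ID d P).@[w] = disc d.-1 (dir_deriv w P).
Proof.
rewrite /ID /discr comp_mpoly_meval; apply: meval_eq => k; rewrite tnth_mktuple.
rewrite /bcoef /dir_deriv; move: (_ + _)%MM => m.
rewrite [X in X.@[_]]mcoeff_lift_xy_comb.
by rewrite mcoeffD !mcoeffZ mevalD !mevalM !mevalXU !mevalC.
Qed.

Lemma dir_deriv_subst (C : comNzRingType) h w (P : {mpoly C[2]}) :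
  dir_deriv w (subst h P) = subst h (dir_deriv (lin h w) P).
Proof.
rewrite /dir_deriv !mderiv_subst substD !substZ /lin !sum2E.
by rewrite -!mul_mpolyC !mpolyCD !mpolyCM; ring.
Qed.

Lemma ID_subst (C : numClosedFieldType) d h (P : {mpoly C[2]}) : P \is d.+2.-homog ->
  ID d.+2 (subst h P) = \det h ^+ (d.+1 * d) *: subst h (ID d.+2 P).
Proof.
move=> hP; apply: mpoly_ext => w; rewrite [RHS]mevalZ meval_subst !meval_ID /= dir_deriv_subst.
by rewrite disc_subst // dir_deriv_homog.
Qed.

Lemma ID_homog (C : numClosedFieldType) d (P : {mpoly C[2]}) : P \is d.+2.-homog ->
  ID d.+2 P \is (d * 2).-homog.
Proof.
move=> hP; apply: meval_homog => w; rewrite !meval_ID /= -disc_scale ?dir_deriv_homog //.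
by congr disc; rewrite /dir_deriv scalerDr !scalerA.
Qed.

Lemma ID_scale (C : numClosedFieldType) d c (P : {mpoly C[2]}) : P \is d.+2.-homog ->
  ID d.+2 (c *: P) = c ^+ (d * 2) *: ID d.+2 P.
Proof.
move=> hP; apply: mpoly_ext => w.
rewrite [RHS]mevalZ [LHS]meval_ID meval_ID /=.
rewrite -disc_scale ?dir_deriv_homog //.
congr (disc _ _); rewrite /dir_deriv !mderivZ scalerDr !scalerA.
by rewrite [w 0 * c]mulrC [w 1 * c]mulrC.
Qed.

(** * Roots, linear factors and the Hessian determinant *)

Lemma mulX_mderivX (C : comNzRingType) n (i : 'I_n) (m : 'X_{1..n}) :
  'X_i * ('X_[m])^`M(i) = (m i)%:R *: ('X_[m] : {mpoly C[n]}).
Proof.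
rewrite mderivX -scalerAr; have [->|mi] := eqVneq (m i) 0%N; first by rewrite !scale0r.
congr (_ *: _); rewrite -mpolyXD; congr 'X_[_]; apply/mnmP => j.
by rewrite mnmDE mnmBE mnm1E; case: eqP => [<-|_] /=; lia.
Qed.

Lemma euler (C : comNzRingType) n (P : {mpoly C[2]}) : P \is n.-homog ->
  'X_0 * P^`M(0) + 'X_1 * P^`M(1) = n%:R *: P.
Proof.
move=> /dhomogP hP; have EP := mpolyE P.
rewrite [X in X^`M(0)]EP [X in X^`M(1)]EP [in RHS]EP !raddf_sum !mulr_sumr -big_split /=.
rewrite !big_seq; apply: eq_bigr => m mP.
rewrite !mderivZ -!scalerAr !mulX_mderivX -scalerDr -scalerDl -natrD scalerA mulrC -scalerA.
have <- : mdeg m = n := hP _ mP.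
congr (_%:R *: _); rewrite mdegE !big_ord_recl big_ord0 addn0.
by congr (_ + m _)%N; apply/val_inj.
Qed.

Lemma euler_meval (C : comNzRingType) n (P : {mpoly C[2]}) v : P \is n.-homog ->
  v 0 * P^`M(0).@[v] + v 1 * P^`M(1).@[v] = n%:R * P.@[v].
Proof. by move/euler/(congr1 (meval v)); rewrite mevalD !mevalM !mevalXU mevalZ. Qed.

Lemma collinear (C : fieldType) (a b : C) (v : 'I_2 -> C) :
  (v 0 != 0) || (v 1 != 0) -> a * v 0 = b * v 1 ->
  exists c, a = c * v 1 /\ b = c * v 0.
Proof.
have [v0 /= v1 e|v0 _ e] := eqVneq (v 0) 0.
  exists (a / v 1); rewrite divfK // v0 mulr0; split=> //.
  by apply: (mulIf v1); rewrite mul0r -e v0 mulr0.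
by exists (b / v 0); rewrite divfK //; split=> //; rewrite mulrAC -e mulfK.
Qed.

Lemma meval_split_form (C : comNzRingType) n (a b : 'I_n -> C) v :
  (split_form a b).@[v] = \prod_(i < n) (a i * v 0 - b i * v 1).
Proof.
rewrite rmorph_prod; apply: eq_bigr => i _ /=.
by rewrite mevalB !mevalZ !mevalXU.
Qed.

(** One of the linear factors of P vanishes at v, hence is a multiple of the
    form vanishing there. *)
Lemma factor_root (C : closedFieldType) n (P : {mpoly C[2]}) v :
  P \is n.+1.-homog -> (v 0 != 0) || (v 1 != 0) -> P.@[v] = 0 ->
  exists2 Q, Q \is n.-homog & P = (v 1 *: 'X_0 - v 0 *: 'X_1) * Q.
Proof.
move=> /homog_split[a [b ->]] nz_v /eqP; rewrite meval_split_form prodf_seq_eq0.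
case/hasP => i _ /=; rewrite subr_eq0 => /eqP/(collinear nz_v)[c [ai bi]].
exists (c *: split_form (fun j => a (lift i j)) (fun j => b (lift i j))).
  by rewrite rpredZ // split_form_homog.
rewrite /split_form (bigD1_ord i) //= ai bi -scalerAr scalerAl; congr (_ * _).
by rewrite scalerBr !scalerA.
Qed.

Lemma mderiv_linear (C : comNzRingType) (a b : C) :
  ((a *: 'X_0 - b *: 'X_1 : {mpoly C[2]})^`M(0) = a%:MP) *
  ((a *: 'X_0 - b *: 'X_1 : {mpoly C[2]})^`M(1) = (- b)%:MP).
Proof.
rewrite !mderivB !mderivZ !mderivXU /= -!mul_mpolyC -!mpolyCM -!mpolyCB.
by rewrite !mulr0 !mulr1 subr0 sub0r.
Qed.

Definition hessian_det (C : comNzRingType) (P : {mpoly C[2]}) : {mpoly C[2]} :=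
  P^`M(0)^`M(0) * P^`M(1)^`M(1) - P^`M(0)^`M(1) ^+ 2.

Section HessianProduct.
Variables (C : comNzRingType) (a b : C) (L Q : {mpoly C[2]}).
Hypotheses (La : L^`M(0) = a%:MP) (Lb : L^`M(1) = b%:MP).

(** The leading term of the Hessian determinant along the line L = 0, for a
    simple factor L.  The combination a Q_y - b Q_x is the derivative of Q along
    that line. *)
Lemma hessian_mul : exists K,
  hessian_det (L * Q) = - (a%:MP * Q^`M(1) - b%:MP * Q^`M(0)) ^+ 2 + L * K.
Proof.
exists (2 * a%:MP * Q^`M(0) * Q^`M(1)^`M(1) + 2 * b%:MP * Q^`M(1) * Q^`M(0)^`M(0)
  + L * Q^`M(0)^`M(0) * Q^`M(1)^`M(1)
  - 2 * (a%:MP * Q^`M(1) + b%:MP * Q^`M(0)) * Q^`M(0)^`M(1) - L * Q^`M(0)^`M(1) ^+ 2).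
rewrite /hessian_det !(mderivM, mderivD, La, Lb, mderivC).
ring.
Qed.

(** The same for a double factor L: the terms of order 0 and 1 in L cancel. *)
Lemma hessian_mul2 : exists K,
  hessian_det (L * (L * Q)) = L ^+ 2 *
    (2 * Q * (a%:MP ^+ 2 * Q^`M(1)^`M(1) + b%:MP ^+ 2 * Q^`M(0)^`M(0)
              - 2 * a%:MP * b%:MP * Q^`M(0)^`M(1))
     - 4 * (a%:MP * Q^`M(1) - b%:MP * Q^`M(0)) ^+ 2 + L * K).
Proof.
exists (4 * a%:MP * Q^`M(0) * Q^`M(1)^`M(1) + 4 * b%:MP * Q^`M(1) * Q^`M(0)^`M(0)
  - 4 * (a%:MP * Q^`M(1) + b%:MP * Q^`M(0)) * Q^`M(0)^`M(1)
  + L * (Q^`M(0)^`M(0) * Q^`M(1)^`M(1) - Q^`M(0)^`M(1) ^+ 2)).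
rewrite /hessian_det !(mderivM, mderivD, La, Lb, mderivC).
ring.
Qed.

End HessianProduct.

Definition vec2 (C : Type) (x y : C) : 'I_2 -> C := fun i => if i == 0 then x else y.

Lemma homog_root_ex (C : closedFieldType) n (P : {mpoly C[2]}) :
  P \is n.+1.-homog -> P != 0 ->
  exists2 v : 'I_2 -> C, (v 0 != 0) || (v 1 != 0) & P.@[v] = 0.
Proof.
move=> /homog_split[a [b ->]] nz_P; exists (vec2 (b 0) (a 0)).
  apply: contraNT nz_P; rewrite negb_or !negbK /vec2 /= => /andP[/eqP b0 /eqP a0].
  by rewrite /split_form (bigD1 0) //= a0 b0 !scale0r subrr mul0r.
by rewrite meval_split_form (bigD1 0) //= /vec2 /= mulrC [b 0 * _]mulrC subrr mulr0.
Qed.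

Lemma Bstar_mult (C : numClosedFieldType) d (P : {mpoly C[2]}) (v : 'I_2 -> C) m Q :
  Bstar d P -> (v 0 != 0) || (v 1 != 0) ->
  P = (v 1 *: 'X_0 - v 0 *: 'X_1) ^+ m * Q -> (m <= 2)%N.
Proof.
case=> _ _ hP nz_v EP; pose p : 'cV[C]_2 := \col_i v i.
apply: (hP p _ Q); last by rewrite /linear_form !mxE.
apply: contraTneq nz_v => p0.
have vE i : v i = 0 by have /matrixP/(_ i 0) := p0; rewrite !mxE.
by rewrite !vE eqxx.
Qed.

Lemma linear_through (C : comNzRingType) (v : 'I_2 -> C) :
  exists L : {mpoly C[2]}, [/\ L = v 1 *: 'X_0 - v 0 *: 'X_1, L.@[v] = 0,
    L^`M(0) = (v 1)%:MP & L^`M(1) = (- v 0)%:MP].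
Proof.
exists (v 1 *: 'X_0 - v 0 *: 'X_1); rewrite !mderiv_linear; split=> //.
by rewrite mevalB !mevalZ !mevalXU mulrC subrr.
Qed.

(** Vanishing second derivatives at v force, by Euler's identity, vanishing
    first derivatives and value, hence a triple root. *)
Lemma second_derivs_neq0 (C : numClosedFieldType) d (P : {mpoly C[2]})
    (v : 'I_2 -> C):
  Bstar d.+3 P -> (v 0 != 0) || (v 1 != 0) ->
  P^`M(0)^`M(0).@[v] = 0 -> P^`M(0)^`M(1).@[v] = 0 -> P^`M(1)^`M(1).@[v] = 0 ->
  False.
Proof.
move=> hP nz_v xx xy yy; have [homP _ _] := hP.
have nN k : (k.+1%:R : C) != 0 by rewrite Num.Theory.pnatr_eq0.
have Ex := euler_meval v (mderiv_homog 0 homP).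
have Ey := euler_meval v (mderiv_homog 1 homP).
have Px : P^`M(0).@[v] = 0.
  by apply: (mulfI (nN d.+1)); rewrite -Ex xx xy !mulr0 addr0.
have Py : P^`M(1).@[v] = 0.
  by apply: (mulfI (nN d.+1)); rewrite -Ey mderiv_comm xy yy !mulr0 addr0.
have P0 : P.@[v] = 0.
  by apply: (mulfI (nN d.+2)); rewrite -(euler_meval v homP) Px Py !mulr0 addr0.
have [Q homQ EQ] := factor_root homP nz_v P0.
have [L [EL L0 La Lb]] := linear_through v; rewrite -EL in EQ.
have Q0 : Q.@[v] = 0.
  move: Px Py; rewrite EQ !mderivM La Lb !mevalD !mevalM !mevalC L0 !mul0r !addr0.
  move=> /eqP; rewrite mulf_eq0 => /orP[/eqP v1|/eqP//].
  move=> /eqP; rewrite mulf_eq0 oppr_eq0 => /orP[/eqP v0|/eqP//].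
  by move: nz_v; rewrite v0 v1 eqxx.
have [Q' homQ' EQ'] := factor_root homQ nz_v Q0.
rewrite -EL in EQ'.
have Q'0 : Q'.@[v] = 0.
  have two (x y : C) : (x != 0) -> x * y * x *+ 2 = 0 -> y = 0.
    move=> nx /eqP; rewrite Num.Theory.mulrn_eq0 /= !mulf_eq0 (negPf nx) /= orbF => /eqP//.
  have [v1|v1] := eqVneq (v 1) 0.
    have v0 : - v 0 != 0 by move: nz_v; rewrite v1 eqxx orbF oppr_eq0.
    apply: (two (- v 0)) => //; rewrite -[RHS]yy EQ EQ'.
    rewrite !(mderivM, mderivD, Lb, mderivC) !(mevalD, mevalM, mevalC) L0; ring.
  apply: (two (v 1)) => //; rewrite -[RHS]xx EQ EQ'.
  rewrite !(mderivM, mderivD, La, mderivC) !(mevalD, mevalM, mevalC) L0; ring.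
have [Q'' _ EQ''] := factor_root homQ' nz_v Q'0.
have : (3 <= 2)%N; last by [].
apply: (Bstar_mult hP nz_v (Q := Q'')).
by rewrite EQ EQ' EQ'' -EL; ring.
Qed.

(** By Euler's identity the leading terms found in [hessian_mul] and
    [hessian_mul2] take at the root v the values - (e Q)^2 and
    - 2 e (e + 1) Q^2, where e is the degree of the cofactor Q. *)
Lemma hessian_neq0 (C : numClosedFieldType) d (P : {mpoly C[2]}) :
  Bstar d.+3 P -> hessian_det P != 0.
Proof.
move=> hP; have [homP nz_P _] := hP.
have nN k : (k.+1%:R : C) != 0 by rewrite Num.Theory.pnatr_eq0.
have [v nz_v P0] := homog_root_ex homP nz_P.
have [Q homQ EQ] := factor_root homP nz_v P0.
have [L [EL L0 La Lb]] := linear_through v; rewrite -EL in EQ.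
have [Q0|Q0] := eqVneq Q.@[v] 0; last first.
  (* v is a simple root. *)
  have [K EK] := hessian_mul Q La Lb.
  have : (hessian_det P).@[v] != 0; last by apply: contraNneq => ->; rewrite meval0.
  rewrite EQ EK mevalD mevalN rmorphXn [(L * K).@[v]]mevalM L0 mul0r addr0 oppr_eq0 /=.
  rewrite expf_neq0 //.
  rewrite mevalB !mevalM !mevalC mulNr opprK addrC (euler_meval v homQ).
  by rewrite mulf_neq0.
(* v is a double root. *)
have [Q' homQ' EQ'] := factor_root homQ nz_v Q0; rewrite -EL in EQ'.
have Q'0 : Q'.@[v] != 0.
  apply/eqP => Q'0; have [Q'' _ EQ''] := factor_root homQ' nz_v Q'0.
  have : (3 <= 2)%N; last by [].
  by apply: (Bstar_mult hP nz_v (Q := Q'')); rewrite EQ EQ' EQ'' -EL; ring.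
have [K EK] := hessian_mul2 Q' La Lb.
have nz_L : L != 0.
  by apply: contraNneq nz_P => L_0; rewrite EQ L_0 mul0r.
rewrite EQ EQ' EK mulf_neq0 ?expf_neq0 //.
set H := (X in X != 0); have : H.@[v] != 0; last by apply: contraNneq => ->; rewrite meval0.
have E := euler_meval v homQ'.
have Ex := euler_meval v (mderiv_homog 0 homQ').
have Ey := euler_meval v (mderiv_homog 1 homQ').
rewrite mderiv_comm in Ey.
have -> : H.@[v] = - (2 * (d.+1 * d.+2)%:R) * Q'.@[v] ^+ 2.
  rewrite /H !(mevalD, mevalN, mevalM, mevalC, rmorphXn) /= L0.
  have S : v 0 * (v 0 * Q'^`M(0)^`M(0).@[v] + v 1 * Q'^`M(0)^`M(1).@[v]) +
      v 1 * (v 0 * Q'^`M(0)^`M(1).@[v] + v 1 * Q'^`M(1)^`M(1).@[v]) =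
      (d * d.+1)%:R * Q'.@[v].
    by rewrite Ex Ey natrM -mulrA -E; ring.
  set q := Q'.@[v] in S E *.
  transitivity (2 * q * ((d * d.+1)%:R * q) - 4 * (d.+1%:R * q) ^+ 2).
    by rewrite -S -E; ring.
  by ring.
by rewrite mulf_neq0 ?expf_neq0 // oppr_eq0 mulf_neq0 // nN.
Qed.

(** * Nonvanishing of ID *)

(** A vanishing discriminant means that two factors are proportional, and a
    common zero of both is a zero of all first derivatives. *)
Lemma disc_eq0 (C : numClosedFieldType) n (F : {mpoly C[2]}) :
  F \is n.+1.-homog -> disc n.+1 F = 0 ->
  exists2 v : 'I_2 -> C, (v 0 != 0) || (v 1 != 0) &
    F^`M(0).@[v] = 0 /\ F^`M(1).@[v] = 0.
Proof.
move=> /homog_split[a [b ->]]; rewrite disc_split_form => /eqP.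
rewrite prodf_seq_eq0 => /hasP[i _ /=]; rewrite prodf_seq_eq0 => /hasP[j _ /=].
rewrite expf_eq0 /= => /andP[lt_ij]; rewrite subr_eq0 => /eqP abE.
have [v nz_v [vi vj]] : exists2 v : 'I_2 -> C, (v 0 != 0) || (v 1 != 0) &
    a i * v 0 - b i * v 1 = 0 /\ a j * v 0 - b j * v 1 = 0.
  have [bi|bi] := boolP ((b i != 0) || (a i != 0)).
    exists (vec2 (b i) (a i)); rewrite /vec2 //=; split; first by ring.
    by rewrite -abE; ring.
  have [bj|bj] := boolP ((b j != 0) || (a j != 0)).
    exists (vec2 (b j) (a j)); rewrite /vec2 //=; split; last by ring.
    by rewrite abE; ring.
  exists (vec2 1 0); first by rewrite /vec2 /= oner_eq0.
  move: bi bj; rewrite !negb_or !negbK => /andP[/eqP -> /eqP ->] /andP[/eqP -> /eqP ->].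
  by rewrite !mul0r subrr.
exists v => //.
have ji : j != i by apply: contraTneq lt_ij => ->; rewrite ltnn.
rewrite /split_form (bigD1 i) //= (bigD1 j) //=.
set M := \prod_(k < _ | _) _; rewrite !mderivM !mevalD !mevalM.
have lv k : (a k *: 'X_0 - b k *: 'X_1).@[v] = a k * v 0 - b k * v 1.
  by rewrite mevalB !mevalZ !mevalXU.
by rewrite !lv vi vj; split; ring.
Qed.

(** Only finitely many directions w can make the derivative of P degenerate:
    for each root p_i of the Hessian determinant the Hessian matrix at p_i has a
    nonzero row, whose kernel is a single direction.  The directions (1, t) to
    be avoided are the roots of one nonzero polynomial q in t. *)
Lemma ID_neq0 (C : numClosedFieldType) d (P : {mpoly C[2]}) :
  Bstar d.+3 P -> ID d.+3 P != 0.
Proof.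
move=> hP; have [homP _ _] := hP.
have homxx : P^`M(0)^`M(0) \is d.+1.-homog by rewrite !mderiv_homog.
have homxy : P^`M(0)^`M(1) \is d.+1.-homog by rewrite !mderiv_homog.
have homyy : P^`M(1)^`M(1) \is d.+1.-homog by rewrite !mderiv_homog.
have homH : hessian_det P \is (d + d.+1).+1.-homog.
  by rewrite rpredB // ?expr2 -addSn; apply: dhomogM.
have [a [b EH]] := homog_split homH.
have nz_H := hessian_neq0 hP.
have nz_p i : (vec2 (b i) (a i) 0 != 0) || (vec2 (b i) (a i) 1 != 0).
  apply: contraNT nz_H; rewrite negb_or !negbK /vec2 /= => /andP[/eqP b0 /eqP a0].
  by rewrite EH /split_form (bigD1 i) //= a0 b0 !scale0r subrr mul0r.
have linP (x y : C) : (x != 0) || (y != 0) -> x%:P + y *: 'X != 0.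
  apply: contraTneq => /polyP xy; have := xy 1; have := xy 0.
  rewrite !coefD !coefC !coefZ !coefX /= mulr0 mulr1 addr0 add0r => -> ->.
  by rewrite eqxx.
(* A nonzero row (x, y) of the Hessian matrix only excludes the root of x + t y. *)
have avoid i : exists2 q : {poly C}, q != 0 & forall t, q.[t] != 0 ->
    P^`M(0)^`M(0).@[vec2 (b i) (a i)] + t * P^`M(0)^`M(1).@[vec2 (b i) (a i)] = 0 ->
    P^`M(0)^`M(1).@[vec2 (b i) (a i)] + t * P^`M(1)^`M(1).@[vec2 (b i) (a i)] = 0 ->
    False.
  set xx := P^`M(0)^`M(0).@[_]; set xy := P^`M(0)^`M(1).@[_].
  set yy := P^`M(1)^`M(1).@[_].
  have hE (x y t : C) : (x%:P + y *: 'X).[t] = x + t * y by rewrite !hornerE mulrC.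
  have [nz|] := boolP ((xx != 0) || (xy != 0)).
    exists (xx%:P + xy *: 'X); first exact: linP.
    by move=> t; rewrite hE => /eqP.
  rewrite negb_or !negbK => /andP[/eqP xx0 /eqP xy0].
  exists (xy%:P + yy *: 'X); last by move=> t; rewrite hE => /eqP.
  apply: linP; rewrite xy0 eqxx /=; apply/eqP => yy0.
  exact: (second_derivs_neq0 hP (nz_p i) xx0 xy0 yy0).
have [q nz_q hq] : exists2 q : {poly C}, q != 0 & forall t i, q.[t] != 0 ->
    P^`M(0)^`M(0).@[vec2 (b i) (a i)] + t * P^`M(0)^`M(1).@[vec2 (b i) (a i)] = 0 ->
    P^`M(0)^`M(1).@[vec2 (b i) (a i)] + t * P^`M(1)^`M(1).@[vec2 (b i) (a i)] = 0 ->
    False.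
  have [q nz_q hq] := fin_all_exists2 avoid.
  exists (\prod_i q i); first by apply/prodf_neq0 => i _; apply: nz_q.
  move=> t i; rewrite horner_prod => /prodf_neq0 nz.
  by apply: hq; apply: nz.
have /closed_nonrootP[t nz_t] := nz_q.
suff : (ID d.+3 P).@[vec2 1 t] != 0 by apply: contraNneq => ->; rewrite meval0.
rewrite meval_ID; apply/eqP => /(disc_eq0 (dir_deriv_homog _ homP))[v nz_v].
rewrite /dir_deriv /vec2 /= !mderivD !mderivZ !mevalD !mevalZ !mul1r.
rewrite [P^`M(1)^`M(0)]mderiv_comm => -[e0 e1].
have /eqP : (hessian_det P).@[v] = 0.
  rewrite /hessian_det mevalB rmorphXn mevalM /=.
  have /eqP := e0; rewrite addr_eq0 => /eqP ->.
  by have /eqP := e1; rewrite addr_eq0 => /eqP ->; ring.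
rewrite EH meval_split_form prodf_seq_eq0 => /hasP[i _ /=].
rewrite subr_eq0 => /eqP/(collinear nz_v)[c [ai bi]].
have nz_c : c != 0.
  by apply: contraTneq (nz_p i) => c0; rewrite /vec2 /= ai bi c0 !mul0r eqxx.
have scale Q : Q \is d.+1.-homog -> Q.@[vec2 (b i) (a i)] = c ^+ d.+1 * Q.@[v].
  move=> /homog_meval <-; apply: meval_eq; apply: forall2; by rewrite /vec2 /= ?ai ?bi.
apply: (hq t i) => //; rewrite !scale // mulrCA -mulrDr.
  by rewrite e0 mulr0.
by rewrite e1 mulr0.
Qed.

(** * Equivariance *)

(** [linear_form p] is, up to sign, the determinant of p and the column of the
    variables. *)
Lemma linear_form_subst (C : numClosedFieldType) (h : 'M[C]_2) (p : 'cV[C]_2) :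
  h \in unitmx ->
  subst h (linear_form p) = \det h *: linear_form (invmx h *m p).
Proof.
move=> uh; rewrite -{1}[p](mulKVmx uh); move: (invmx h *m p) => q.
rewrite /linear_form substD -[in LHS]scaleNr !substZ !substXU det2E !mxE !sum2E.
by rewrite -!mul_mpolyC !mpolyCN !mpolyCB !mpolyCD !mpolyCM; ring.
Qed.

Lemma subst_homog (C : numClosedFieldType) h n (P : {mpoly C[2]}) :
  P \is n.-homog -> subst h P \is n.-homog.
Proof.
move=> hP; apply: meval_homog => v; rewrite !meval_subst -(homog_meval _ _ hP).
apply: meval_eq => i; rewrite /lin mulr_sumr.
by apply: eq_bigr => j _; rewrite mulrCA.
Qed.

Lemma substK (C : comUnitRingType) (h : 'M[C]_2) : h \in unitmx ->
  cancel (subst h) (subst (invmx h)).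
Proof. by move=> uh P; rewrite subst_subst mulmxV // subst1. Qed.

Lemma subst_neq0 (C : comUnitRingType) (h : 'M[C]_2) P : h \in unitmx ->
  P != 0 -> subst h P != 0.
Proof.
by move=> uh; apply: contra_neq => P0; rewrite -(substK uh P) P0 /subst comp_mpoly0.
Qed.

(** A factor L^m of P o h is carried by h^-1 to a factor of P of the same
    multiplicity. *)
Lemma Bstar_subst (C : numClosedFieldType) d h (P : {mpoly C[2]}) :
  h \in unitmx -> Bstar d P -> Bstar d (subst h P).
Proof.
move=> uh [homP nz_P multP]; split; rewrite ?subst_homog ?subst_neq0 // => p m Q nz_p EP.
have uh' : invmx h \in unitmx by rewrite unitmx_inv.
apply: (multP (h *m p) m (\det (invmx h) ^+ m *: subst (invmx h) Q)).
  by apply: contraNneq nz_p => p0; rewrite -(mulKmx uh p) p0 mulmx0.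
rewrite -(substK uh P) EP substM substX linear_form_subst // invmxK.
by rewrite exprZn -scalerAl scalerAr.
Qed.

Lemma Bstar_scale (C : numClosedFieldType) d (c : C) (P : {mpoly C[2]}) :
  c != 0 -> Bstar d P -> Bstar d (c *: P).
Proof.
move=> nz_c [homP nz_P multP]; split; rewrite ?rpredZ // ?scaler_eq0 ?negb_or ?nz_c //.
move=> p m Q nz_p EP; apply: (multP p m (c^-1 *: Q)) => //.
by rewrite -scalerAr -EP scalerA mulVf // scale1r.
Qed.

Lemma subst_scalemx (C : closedFieldType) (c : C) h n (P : {mpoly C[2]}) :
  P \is n.-homog -> subst (c *: h) P = c ^+ n *: subst h P.
Proof.
move=> hP; apply: mpoly_ext => v; rewrite [RHS]mevalZ !meval_subst -homog_meval //.
apply: meval_eq => i; rewrite /lin mulr_sumr.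
by apply: eq_bigr => j _; rewrite mxE mulrA.
Qed.

Lemma ID_equivariant (C : numClosedFieldType) d (P : {mpoly C[2]}) (k : C) h :
  Bstar d.+3 P -> k != 0 -> h \in unitmx ->
  proj_eq (d.+1 * 2) (ID d.+3 (subst h (k *: P))) (subst h (ID d.+3 P)).
Proof.
move=> hP nz_k uh; have [homP _ _] := hP.
have nz_I : subst h (ID d.+3 P) != 0 by rewrite subst_neq0 ?ID_neq0.
have homI : subst h (ID d.+3 P) \is (d.+1 * 2).-homog by rewrite subst_homog ?ID_homog.
have EI : ID d.+3 (subst h (k *: P)) =
    (\det h ^+ (d.+2 * d.+1) * k ^+ (d.+1 * 2)) *: subst h (ID d.+3 P).
  have homkP : k *: P \is d.+3.-homog by rewrite rpredZ.
  by rewrite (ID_subst h homkP) (ID_scale k homP) substZ scalerA.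
have nz_c : \det h ^+ (d.+2 * d.+1) * k ^+ (d.+1 * 2) != 0.
  by rewrite mulf_neq0 ?expf_neq0 // -unitfE -unitmxE.
rewrite EI; split=> //; first by rewrite rpredZ.
  by rewrite scaler_eq0 negb_or nz_c.
by exists (\det h ^+ (d.+2 * d.+1) * k ^+ (d.+1 * 2)).
Qed.

(** Scalar matrices act on forms by scalars, so rescaling g amounts to
    rescaling the form. *)
Lemma act_scale (C : numClosedFieldType) (c l : C) (g : 'M[C]_2) n (P : {mpoly C[2]}) :
  c != 0 -> g \in unitmx -> P \is n.-homog ->
  act (c *: g) (l *: P) = subst (invmx g) ((c^-1 ^+ n * l) *: P).
Proof.
move=> nz_c ug hP.
have Eg : invmx (c *: g) = c^-1 *: invmx g by rewrite invmxZ // unitmxZ ?unitfE.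
rewrite -[LHS]/(subst (invmx (c *: g)) (l *: P)) Eg.
by rewrite !substZ (subst_scalemx _ _ hP) !scalerA mulrC.
Qed.

Theorem theorem1 (R : realType) (d : nat) (P : {mpoly R[i][2]})
    (g : 'M[R[i]]_2) (hd : (3 <= d)%N) (hP : Bstar d P) (hg : g \in unitmx) :
  [/\ Bstar d (act g P),
      proj_eq (2 * d - 4) (ID d (act g P)) (act g (ID d P)) &
      forall (c : R[i]) (Q : {mpoly R[i][2]}), c != 0 -> proj_eq d Q P ->
        Bstar d (act (c *: g) Q) /\
        proj_eq (2 * d - 4) (ID d (act (c *: g) Q)) (act g (ID d P))].
Proof.
case: d hd hP => [|[|[|d]]] // _ hP.
have -> : (2 * d.+3 - 4 = d.+1 * 2)%N by lia.
have uh : invmx g \in unitmx by rewrite unitmx_inv.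
have actE Q : act g Q = subst (invmx g) Q by [].
rewrite !actE; split; first exact: Bstar_subst.
  by have := ID_equivariant hP (oner_neq0 _) uh; rewrite scale1r.
move=> c _ nz_c [_ _ homP _ [l nz_l ->]].
rewrite (act_scale l nz_c hg homP).
have nz_k : c^-1 ^+ d.+3 * l != 0 by rewrite mulf_neq0 ?expf_neq0 ?invr_eq0.
split; first by apply: Bstar_subst => //; apply: Bstar_scale.
exact: ID_equivariant.
Qed.
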